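(* Let $K \subset \mathbb{R}^n$ be a convex body in Loewner position, and let $c \in \mathbb{R}^n$ and $s \geq 1$ be such that $K \subset s\,(c-K) + c$. Then $$\frac{1}{\sqrt{ns}}\,\mathbb{B}_2^n + \frac{s+1}{2s}\,c \subset K.$$
   Context: A convex body in $\mathbb{R}^n$ is a compact convex set with non-empty interior. $\mathbb{B}_2^n$ is the Euclidean unit ball. $K$ is in Loewner position if $\mathbb{B}_2^n$ is the unique ellipsoid of minimal volume containing $K$. Here $s\,(c-K)+c = \{s(c-x)+c : x \in K\}$. *)

(* Defs.v *)
From mathcomp Require Import all_boot all_order all_algebra.
From mathcomp Require Import all_classical all_reals all_analysis measurable_realfun.
Import Order.TTheory GRing.Theory Num.Theory.
Import numFieldNormedType.Exports.

Set Implicit Arguments.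
Unset Strict Implicit.
Unset Printing Implicit Defensive.

Local Open Scope classical_set_scope.
Local Open Scope ring_scope.

(* The library norm `|x| on 'rV[R]_n is the max norm, so the Euclidean norm has
   to be introduced separately; the topologies agree. *)
Definition enorm (R : realType) (n : nat) (x : 'rV[R]_n) : R :=
  Num.sqrt (\sum_(i < n) x 0 i ^+ 2).

Definition eball (R : realType) (n : nat) : set 'rV[R]_n :=
  [set x | enorm x <= 1].
Arguments eball : clear implicits.

Definition convex_body (R : realType) (n : nat) (K : set 'rV[R]_n) : Prop :=
  [/\ compact K, convex_set K & interior K !=set0].

(* n-dimensional Lebesgue measure, as the iterated product of the Lebesgue
   measure on R: the recursive clause is what the product measure
   lebesgue_measure \x vol R n unfolds to, the first coordinate of the row
   vector being split off. It is meant for Borel sets A; ellipsoids are closed.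
   The lemma vol_box checks the normalisation. *)
Fixpoint vol (R : realType) (n : nat) : set 'rV[R]_n -> \bar R :=
  match n return set 'rV[R]_n -> \bar R with
  | 0 => fun A => (\1_A (0 : 'rV[R]_0))%:E
  | m.+1 => fun A =>
      (\int[lebesgue_measure]_x
         vol [set y : 'rV[R]_m | A (row_mx (x%:M : 'rV[R]_1) y)])%E
  end.

Lemma vol_box (R : realType) (n : nat) (a b : 'rV[R]_n) :
  (forall i, a 0 i <= b 0 i) ->
  vol [set x : 'rV[R]_n | forall i, a 0 i <= x 0 i <= b 0 i] =
  (\prod_(i < n) (b 0 i - a 0 i))%:E.
Proof.
elim: n a b => [|n IH] a b ab.
  by rewrite /= indicE big_ord0 mem_set// => -[].
rewrite /= big_ord_recl.
set p := \prod_(i < n) _.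
have sec (x : R) :
    vol [set y : 'rV[R]_n | forall i, a 0 i <=
      (row_mx (x%:M : 'rV[R]_1) y : 'rV[R]_n.+1) 0 i <= b 0 i] =
    (p%:E * (\1_`[a 0 ord0, b 0 ord0]%classic x)%:E)%E.
  have x0 y : (row_mx (x%:M : 'rV[R]_1) y : 'rV[R]_n.+1) 0 ord0 = x.
    have -> : (ord0 : 'I_n.+1) = lshift n (ord0 : 'I_1) by exact/val_inj.
    by apply: etrans (row_mxEl _ _ _ _) _; rewrite mxE eqxx.
  have xS y i : (row_mx (x%:M : 'rV[R]_1) y : 'rV[R]_n.+1) 0 (lift ord0 i)
      = y 0 i.
    have -> : lift ord0 i = rshift 1 i by exact/val_inj.
    exact: row_mxEr.
  have [xab|xab] := boolP (x \in `[a 0 ord0, b 0 ord0]%classic).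
    rewrite indicE xab mule1 /p.
    have -> : \prod_(i < n) (b 0 (lift ord0 i) - a 0 (lift ord0 i)) =
        \prod_(i < n) ((\row_j b 0 (lift ord0 j)) 0 i -
                       (\row_j a 0 (lift ord0 j)) 0 i).
      by apply: eq_bigr => i _; rewrite !mxE.
    rewrite -IH; last by move=> i; rewrite !mxE.
    congr (vol _); apply/seteqP; split => y /= hy i.
      by rewrite !mxE -(xS y); exact: hy.
    have [->|[j ->]] : i = ord0 \/ exists j, i = lift ord0 j.
      by case: (unliftP ord0 i) => [j|] ->; [right; exists j|left].
    - by rewrite x0; move: xab; rewrite inE/= in_itv.
    - by rewrite xS; have := hy j; rewrite !mxE.
  rewrite indicE (negbTE xab) mule0.
  have -> : [set y : 'rV[R]_n | forall i, a 0 i <=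
      (row_mx (x%:M : 'rV[R]_1) y : 'rV[R]_n.+1) 0 i <= b 0 i] = set0.
    apply/seteqP; split => // y /= /(_ ord0); rewrite x0 => hx.
    by move: xab; rewrite notin_setE/= in_itv/= hx.
  elim: n {IH a b ab p xab x0 xS x} => [|n IH] /=; first by rewrite indicE in_set0.
  under eq_integral do rewrite (_ : [set _ | _] = set0)// IH.
  by rewrite integral0.
under eq_integral do rewrite sec.
rewrite ge0_integralZl//; first last.
- by rewrite lee_fin prodr_ge0// => i _; rewrite subr_ge0.
- exact/measurable_EFinP/measurable_indic.
have lm : lebesgue_measure (`[a 0 ord0, b 0 ord0]%classic : set R) =
    (b 0 ord0 - a 0 ord0)%:E.
  rewrite lebesgue_measure_itv/= lte_fin; have [//|l] := ltP (a 0 ord0) (b 0 ord0).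
  by rewrite (le_anti (introT andP (conj l (ab ord0)))) subrr.
by rewrite integral_indic// setIT [X in (_ * X)%E]lm -EFinM mulrC.
Qed.

Definition ellipsoid (R : realType) (n : nat) (E : set 'rV[R]_n) : Prop :=
  exists (A : 'M[R]_n) (b : 'rV[R]_n),
    A \in unitmx /\ E = [set x *m A + b | x in eball R n].

Definition min_vol_ellipsoid (R : realType) (n : nat)
    (K E : set 'rV[R]_n) : Prop :=
  [/\ ellipsoid E, K `<=` E &
      forall E' : set 'rV[R]_n, ellipsoid E' -> K `<=` E' ->
        (vol E <= vol E')%E].

Definition loewner_position (R : realType) (n : nat) (K : set 'rV[R]_n) : Prop :=
  min_vol_ellipsoid K (eball R n) /\
  forall E : set 'rV[R]_n, min_vol_ellipsoid K E -> E = eball R n.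

(* Main.v *)
Require Import Defs.
From mathcomp Require Import all_boot all_order all_algebra.
From mathcomp Require Import all_classical all_reals all_analysis.
From mathcomp Require Import measurable_realfun.
From mathcomp Require Import ring lra.
Import Order.TTheory GRing.Theory Num.Theory.
Import numFieldNormedType.Exports.
Local Open Scope classical_set_scope.
Local Open Scope ring_scope.

(** The Loewner position enters through a bound on slabs: if [v] is a unit vector and [lo <= <x, v> <= hi] on [K], then
    [n * lo * hi <= -1] ([slab_of_min_ball]). It follows from John's
    decomposition of the identity over the contact points, but the minimality
    of the unit ball gives it directly. On [K] both [|x|^2 - 1] and
    [(<x, v> - lo) * (<x, v> - hi)] are nonpositive, so for every [t >= 0] the
    set [K] lies in the ellipsoid
      [|x|^2 - 1 + t * (<x, v> - lo) * (<x, v> - hi) <= 0].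
    Its squared volume, relative to that of the ball, is [r ^ n / (1 + t)] with
    [r = 1 - t * lo * hi + O(t^2)], which drops below [1] for small [t] as soon
    as [n * lo * hi > -1].

    The volumes are compared with an explicit formula for the sublevel sets of
    [|x - b|^2 + t * <x - b, v>^2] ([vol_quad]). This family of sets is stable
    under sections by a fixed first coordinate: completing the square in the
    remaining coordinates produces a set of the same shape one dimension lower.
    The iterated integral is thus computed by induction on the dimension, with
    one affine substitution on the line at each step
    ([integral_radial_pow]), and linear changes of variables in several
    dimensions are avoided.

    For the theorem, suppose that a point [p] of the small ball is not in [K].
    A unit vector [v] and a point [q] of [K] exist with
    [<x, v> <= h = <q, v> < <p, v>] on [K] ([strict_separation]). The slab bound
    with [lo = -1] gives [h > 0]. The inclusion of [K] in [s (c - K) + c] gives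
    the lower bound [lo = (s + 1) <c, v> - s h], and the slab bound becomes
    [h (h - 2 a) >= 1 / (n s)] with [a = (s + 1) / (2 s) * <c, v>]. For [h > 0]
    this forces [h >= a + 1 / sqrt (n s)], while [h < <p, v>] says the
    opposite. *)

Set Implicit Arguments.
Unset Strict Implicit.
Unset Printing Implicit Defensive.

(** * One-dimensional integrals *)

(** The volume of a Euclidean ball of squared radius [r], up to a factor
    depending on [n] only. The test on [r] makes the function vanish where the
    ball is empty, which matters for [n = 0] since [0 ^+ 0 = 1]. *)
Definition radial_pow (R : realType) (n : nat) (r : R) : R :=
  if 0 <= r then Num.sqrt r ^+ n else 0.

(** The ratio of the volumes of the unit balls in dimensions [m.+1] and [m]. *)
Definition cap_mass (R : realType) (m : nat) : R :=
  \int[lebesgue_measure]_(x in `[(-1 : R), 1]) Num.sqrt (1 - x ^+ 2) ^+ m.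

Lemma cap_profile_continuous (R : realType) (m : nat) :
  continuous (fun x : R => Num.sqrt (1 - x ^+ 2) ^+ m).
Proof.
move=> x; apply: (@continuous_comp _ _ _ (fun x : R => Num.sqrt (1 - x ^+ 2))
  (fun y => y ^+ m)); last exact: exprn_continuous.
apply: (@continuous_comp _ _ _ (fun x : R => 1 - x ^+ 2) Num.sqrt); last first.
  exact: sqrt_continuous.
by apply: cvgB; [exact: cvg_cst|exact: exprn_continuous].
Qed.

Lemma cap_profile_integrable (R : realType) (m : nat) (a b : R) :
  (lebesgue_measure : measure (measurableTypeR R) R).-integrable `[a, b]
    (EFin \o (fun x => Num.sqrt (1 - x ^+ 2) ^+ m)).
Proof.
apply: continuous_compact_integrable; first exact: segment_compact.
by apply: continuous_subspaceT; exact: cap_profile_continuous.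
Qed.

Lemma cap_massE (R : realType) (m : nat) :
  ((cap_mass R m)%:E = \int[lebesgue_measure]_(x in `[(-1)%R, 1%R])
     (Num.sqrt (1 - x ^+ 2) ^+ m)%:E)%E.
Proof.
rewrite /cap_mass /Rintegral fineK//.
apply: (@integrable_fin_num _ _ _ lebesgue_measure) => //.
exact: cap_profile_integrable.
Qed.

Lemma cap_mass_gt0 (R : realType) (m : nat) : 0 < cap_mass R m.
Proof.
(* On [-1/2, 1/2], an interval of length 1, the integrand is at least
   (1/2) ^ m. *)
have h : 0 < 2^-1 ^+ m :> R by rewrite exprn_gt0// invr_gt0.
apply: (lt_le_trans h); rewrite -lee_fin cap_massE.
have mI (a b : R) : measurable (`[a, b] : set (measurableTypeR R)) by [].
have hm (a b : R) : measurable_fun `[a, b]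
    (EFin \o (fun x : R => Num.sqrt (1 - x ^+ 2) ^+ m)).
  exact: (measurable_int _ (@cap_profile_integrable R m a b)).
apply: (@le_trans _ _ (\int[lebesgue_measure]_(x in `[(- 2^-1)%R, (2^-1)%R])
     (Num.sqrt (1 - x ^+ 2) ^+ m)%:E)%E); last first.
  apply: (@ge0_subset_integral _ _ _ lebesgue_measure) => //=; first exact: hm.
  by move=> x /=; rewrite !in_itv/= => /andP[? ?]; apply/andP; split; lra.
apply: (@le_trans _ _ (\int[lebesgue_measure]_(x in `[(- 2^-1)%R, (2^-1)%R])
     cst (2^-1 ^+ m)%R%:E x)%E).
  rewrite integral_cst// [X in (_ * X)%E]lebesgue_measure_itv/= lte_fin.
  rewrite ifT; last by lra.
  rewrite -EFinD -EFinM lee_fin opprK.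
  by rewrite (_ : 2^-1 + 2^-1 = 1 :> R) ?mulr1//; lra.
apply: (@ge0_le_integral _ _ _ lebesgue_measure) => //=.
- exact: hm.
- move=> x; rewrite in_itv/= => /andP[x1 x2].
  rewrite lee_fin lerXn2r ?nnegrE ?invr_ge0 ?sqrtr_ge0//.
  have -> : (2^-1 : R) = Num.sqrt (2^-1 ^+ 2).
    by rewrite sqrtr_sqr ger0_norm// invr_ge0.
  by apply: ler_wsqrtr; nra.
Qed.

Lemma measurable_radial_pow (R : realType) (n : nat) :
  measurable_fun [set: R] (radial_pow n : R -> R).
Proof.
apply: measurable_fun_ifT => //.
  by apply: measurable_fun_ler; [exact: measurable_cst|exact: measurable_id].
apply: continuous_measurable_fun => x.
apply: (@continuous_comp _ _ _ (@Num.sqrt R) (fun y => y ^+ n)).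
  exact: sqrt_continuous.
exact: exprn_continuous.
Qed.

(** Homogeneity in [r] and [s] comes from the substitution
    [u = (x - b) / sqrt (r / s)], which maps the support of the integrand onto
    [[-1, 1]]. *)
Lemma integral_radial_pow (R : realType) (m : nat) (s b r : R) : 0 < s ->
  (\int[lebesgue_measure]_x (radial_pow m (r - s * (x - b) ^+ 2))%:E =
   (radial_pow m.+1 r / Num.sqrt s * cap_mass R m)%:E)%E.
Proof.
move=> s0.
have [r0|r0] := ltP r 0.
  rewrite /radial_pow (lt_geF r0) 2!mul0r; apply: integral0_eq => x _.
  rewrite lt_geF//; apply: le_lt_trans r0.
  by rewrite gerBl mulr_ge0 ?sqr_ge0// ltW.
pose p : R := Num.sqrt (r / s).
have rs0 : 0 <= r / s by rewrite divr_ge0// ltW.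
have p0 : 0 <= p by exact: sqrtr_ge0.
have ps : r = s * p ^+ 2 by rewrite sqr_sqrtr// mulrCA mulfV ?mulr1// gt_eqF.
have sE x : (0 <= r - s * (x - b) ^+ 2) = (b - p <= x <= b + p).
  rewrite ps -mulrBr pmulr_rge0// subr_ge0 -ler_sqrt ?exprn_ge0//.
  rewrite !sqrtr_sqr (ger0_norm p0) ler_norml.
  by apply/idP/idP => /andP[? ?]; apply/andP; split; lra.
transitivity (\int[lebesgue_measure]_(x in `[(b - p)%R, (b + p)%R])
    (Num.sqrt (r - s * (x - b) ^+ 2) ^+ m)%:E)%E.
  rewrite [RHS]integral_mkcond; apply: eq_integral => x _.
  rewrite patchE /radial_pow sE.
  by case: ifPn => h; [rewrite ifT//| rewrite ifF//]; rewrite ?inE/= ?in_itv//;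
    apply/negbTE; rewrite notin_setE/= in_itv/=; exact/negP.
rewrite /radial_pow r0.
(* For r = 0 the support is a point and no substitution is possible. *)
have [p00|pn0] := eqVneq p 0.
  have -> : r = 0 by rewrite ps p00 expr0n mulr0.
  by rewrite p00 subr0 addr0 set_itv1 integral_set1 sqrtr0 expr0n !mul0r.
have {}p0 : 0 < p by rewrite lt_neqAle eq_sym pn0.
pose F (x : R) : R := (x - b) / p.
have dF (x : R) : is_derive x (1 : R) F p^-1.
  have -> : F = p^-1 \*: (id - cst b).
    by apply/funext => y; rewrite /F mulrC.
  by apply: is_derive_eq; rewrite subr0 [LHS]mulr1.
have F'E : derive1 F = cst p^-1.
  by apply/funext => x; rewrite derive1E; apply: derive_val.
have cF : continuous F.
  by move=> x; apply: cvgMr_tmp; apply: cvgB; [exact: cvg_id|exact: cvg_cst].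
have Fa : F (b - p) = -1 by rewrite /F; field.
have Fb : F (b + p) = 1 by rewrite /F; field.
have h := @integration_by_substitution_increasing R F
  (fun x => Num.sqrt (1 - x ^+ 2) ^+ m) (b - p) (b + p).
rewrite Fa Fb -cap_massE in h.
rewrite mulrC EFinM h; first last.
- by apply: continuous_subspaceT; exact: cap_profile_continuous.
- split; first by move=> x _; apply: ex_derive.
  + exact/cvg_at_right_filter/cF.
  + exact/cvg_at_left_filter/cF.
- by rewrite F'E; exact: is_cvg_cst.
- by rewrite F'E; exact: is_cvg_cst.
- by move=> x _; rewrite F'E; exact: cvg_cst.
- by move=> x y _ _ xy; rewrite /F ltr_pM2r ?invr_gt0// ltrD2r.
- by lra.
rewrite muleC -ge0_integralZl//=; first last.
- move=> x _; rewrite lee_fin F'E/= mulr_ge0// ?invr_ge0 ?(ltW p0)//.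
  by rewrite exprn_ge0// sqrtr_ge0.
- apply/measurable_EFinP/measurable_funM.
  + apply: measurable_funTS; apply: continuous_measurable_fun => x.
    apply: continuous_comp; first exact: cF.
    exact: cap_profile_continuous.
  + by rewrite F'E; exact: measurable_cst.
apply: eq_integral => x _; rewrite -EFinM; congr EFin.
rewrite F'E/=.
have -> : r - s * (x - b) ^+ 2 = r * (1 - F x ^+ 2).
  by rewrite ps /F; field.
have -> : Num.sqrt s = Num.sqrt r / p.
  by rewrite ps sqrtrM ?(ltW s0)// sqrtr_sqr gtr0_norm// mulfK.
rewrite sqrtrM// exprMn /= [in RHS]exprS.
rewrite -[X in _ = _ * X]/(Num.sqrt (1 - F x ^+ 2) ^+ m * p^-1).
have : Num.sqrt r != 0.
  by rewrite sqrtr_eq0 -ltNge ps mulr_gt0// exprn_gt0.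
by move=> hr; field; rewrite hr pn0.
Qed.

(** * Euclidean inner product *)

Definition dotv (R : realType) (n : nat) (x y : 'rV[R]_n) : R :=
  \sum_(i < n) x 0 i * y 0 i.

Lemma dotvC (R : realType) n (x y : 'rV[R]_n) : dotv x y = dotv y x.
Proof. by apply: eq_bigr => i _; rewrite mulrC. Qed.

Lemma dotvDl (R : realType) n (x y z : 'rV[R]_n) :
  dotv (x + y) z = dotv x z + dotv y z.
Proof. by rewrite -big_split; apply: eq_bigr => i _; rewrite mxE mulrDl. Qed.

Lemma dotvZl (R : realType) n (k : R) (x z : 'rV[R]_n) :
  dotv (k *: x) z = k * dotv x z.
Proof. by rewrite mulr_sumr; apply: eq_bigr => i _; rewrite mxE mulrA. Qed.

Lemma dotvBl (R : realType) n (x y z : 'rV[R]_n) :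
  dotv (x - y) z = dotv x z - dotv y z.
Proof. by rewrite -scaleN1r dotvDl dotvZl mulN1r. Qed.

Lemma dotvDr (R : realType) n (x y z : 'rV[R]_n) :
  dotv z (x + y) = dotv z x + dotv z y.
Proof. by rewrite !(dotvC z) dotvDl. Qed.

Lemma dotvZr (R : realType) n (k : R) (x z : 'rV[R]_n) :
  dotv z (k *: x) = k * dotv z x.
Proof. by rewrite !(dotvC z) dotvZl. Qed.

Lemma dotvBr (R : realType) n (x y z : 'rV[R]_n) :
  dotv z (x - y) = dotv z x - dotv z y.
Proof. by rewrite !(dotvC z) dotvBl. Qed.

Lemma dotv_ge0 (R : realType) n (x : 'rV[R]_n) : 0 <= dotv x x.
Proof. by apply: sumr_ge0 => i _; rewrite -expr2 sqr_ge0. Qed.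

Lemma dotv_eq0 (R : realType) n (x : 'rV[R]_n) : (dotv x x == 0) = (x == 0).
Proof.
rewrite psumr_eq0; last by move=> i _; rewrite -expr2 sqr_ge0.
apply/allP/eqP => [h|-> i _]; last by rewrite mxE mul0r eqxx.
apply/rowP => i; rewrite mxE; have := h i (mem_index_enum i).
by rewrite -expr2 sqrf_eq0 => /eqP.
Qed.

Lemma mem_eball (R : realType) n (x : 'rV[R]_n) : eball R n x <-> dotv x x <= 1.
Proof.
by rewrite /eball/= /enorm -[X in _ <= X]sqrtr1 ler_sqrt//.
Qed.

(** * Volume of a one-parameter family of ellipsoids *)

Definition tailv (R : realType) (n : nat) (x : 'rV[R]_n.+1) : 'rV[R]_n :=
  \row_j x 0 (lift ord0 j).

Lemma dotv_recl (R : realType) n (x y : 'rV[R]_n.+1) :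
  dotv x y = x 0 ord0 * y 0 ord0 + dotv (tailv x) (tailv y).
Proof.
rewrite /dotv big_ord_recl; congr (_ + _).
by apply: eq_bigr => i _; rewrite !mxE.
Qed.

(** The way in which [vol] reassembles a point from its first coordinate and
    the others. *)
Definition consv (R : realType) (n : nat) (x : R) (y : 'rV[R]_n) :
  'rV[R]_n.+1 := row_mx (x%:M : 'rV[R]_1) y.

Lemma consv_head (R : realType) n (x : R) (y : 'rV[R]_n) :
  consv x y 0 ord0 = x.
Proof.
have -> : (ord0 : 'I_n.+1) = lshift n (ord0 : 'I_1) by exact/val_inj.
by apply: etrans (row_mxEl _ _ _ _) _; rewrite mxE eqxx.
Qed.

Lemma tailv_consv (R : realType) n (x : R) (y : 'rV[R]_n) :
  tailv (consv x y) = y.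
Proof.
apply/rowP => j; rewrite mxE.
have -> : lift ord0 j = rshift 1 j by exact/val_inj.
exact: row_mxEr.
Qed.

Lemma tailvB (R : realType) n (x y : 'rV[R]_n.+1) :
  tailv (x - y) = tailv x - tailv y.
Proof. by apply/rowP => j; rewrite !mxE. Qed.

(** Completing the square in [y]. The quantity [D] is the determinant of the
    form restricted to the last coordinates, the last coefficient of the
    right-hand side is the ratio of the two determinants, and [c] is the
    minimiser in [y]. *)
Lemma quad_form_section (R : realType) n (v b : 'rV[R]_n.+1) (t x : R)
    (y : 'rV[R]_n) (D := 1 + t * dotv (tailv v) (tailv v))
    (z := x - b 0 ord0)
    (c := tailv b - (t * z * v 0 ord0 / D) *: tailv v) : 0 < D ->
  dotv (consv x y - b) (consv x y - b) + t * dotv (consv x y - b) v ^+ 2 =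
  dotv (y - c) (y - c) + t * dotv (y - c) (tailv v) ^+ 2
    + (1 + t * v 0 ord0 ^+ 2 / D) * z ^+ 2.
Proof.
move=> D0; rewrite !dotv_recl.
have -> : (consv x y - b) 0 ord0 = z by rewrite [LHS]mxE consv_head mxE.
rewrite tailvB tailv_consv /c opprB addrA addrAC.
move: (y - tailv b) => w.
rewrite !(dotvDl, dotvDr, dotvZl, dotvZr) (dotvC (tailv v) w).
move: D0; rewrite /D; move: (dotv (tailv v) (tailv v)) => N D0.
by field; exact: lt0r_neq0.
Qed.

(** The form has determinant [1 + t * |v|^2]. In the induction step each section
    belongs to the same family by [quad_form_section], with a level depending
    quadratically on the first coordinate, and the determinants telescope. *)
Lemma vol_quad (R : realType) (n : nat) (v b : 'rV[R]_n) (t r : R) : 0 <= t ->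
  vol [set x | dotv (x - b) (x - b) + t * dotv (x - b) v ^+ 2 <= r] =
  ((\prod_(m < n) cap_mass R m) * radial_pow n r
    / Num.sqrt (1 + t * dotv v v))%:E.
Proof.
move=> t0; elim: n v b r => [|n IH] v b r.
  rewrite /= indicE /radial_pow big_ord0 expr0 mul1r; congr EFin.
  rewrite [dotv v v]big_ord0 mulr0 addr0 sqrtr1 divr1.
  have -> : (0 \in [set x : 'rV[R]_0 |
      dotv (x - b) (x - b) + t * dotv (x - b) v ^+ 2 <= r]) = (0 <= r).
    by apply/idP/idP; rewrite inE/= /dotv !big_ord0 expr0n mulr0 addr0.
  by case: ifP.
rewrite [vol _]/=.
pose v1 := v 0 ord0; pose b1 := b 0 ord0.
pose D := 1 + t * dotv (tailv v) (tailv v).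
have D0 : 0 < D by rewrite ltr_pwDl// mulr_ge0// dotv_ge0.
pose s := 1 + t * v1 ^+ 2 / D.
have s0 : 0 < s.
  by rewrite ltr_pwDl// divr_ge0 ?(ltW D0)// mulr_ge0// sqr_ge0.
pose k := (\prod_(m < n) cap_mass R m) / Num.sqrt D.
have k0 : 0 <= k.
  by rewrite divr_ge0 ?sqrtr_ge0// prodr_ge0// => i _; exact/ltW/cap_mass_gt0.
transitivity (\int[lebesgue_measure]_x
    (k%:E * (radial_pow n (r - s * (x - b1) ^+ 2))%:E))%E.
  apply: eq_integral => x _.
  pose c := tailv b - (t * (x - b1) * v1 / D) *: tailv v.
  transitivity (vol [set y | dotv (y - c) (y - c) +
      t * dotv (y - c) (tailv v) ^+ 2 <= r - s * (x - b1) ^+ 2]).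
    by congr vol; apply/seteqP; split => y /=;
      rewrite -/(consv x y) quad_form_section// lerBrDr.
  by rewrite IH -EFinM /k /D; congr EFin; rewrite mulrAC.
rewrite ge0_integralZl//; first last.
- move=> x _; rewrite lee_fin /radial_pow; case: ifP => // _;
    by rewrite ?lexx ?exprn_ge0// sqrtr_ge0.
- apply/measurable_EFinP.
  apply: (measurableT_comp (@measurable_radial_pow R n)).
  apply: continuous_measurable_fun => x.
  apply: cvgB; first exact: cvg_cst.
  apply: cvgMl_tmp; apply: (@continuous_comp _ _ _ (fun x => x - b1)
    (fun y : R => y ^+ 2)); last exact: exprn_continuous.
  by apply: cvgB; [exact: cvg_id|exact: cvg_cst].
rewrite integral_radial_pow// -EFinM; congr EFin.
rewrite big_ord_recr/= dotv_recl -/v1.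
have -> : 1 + t * (v1 * v1 + dotv (tailv v) (tailv v)) = D * s.
  by rewrite /s /D; field; exact: lt0r_neq0.
rewrite sqrtrM ?ltW// /k.
by field; rewrite !gt_eqF ?sqrtr_gt0.
Qed.

Lemma mulmx_rank1 (R : realType) n (y v : 'rV[R]_n) :
  y *m (v^T *m v) = dotv y v *: v.
Proof.
apply/rowP => j; rewrite mulmxA mxE big_ord1 !mxE; congr (_ * _).
by apply: eq_bigr => i _; rewrite mxE.
Qed.

(** The matrix [1 + h v^T v] is a square root of [1 + t v^T v] when
    [(1 + h)^2 = 1 + t], and its inverse is [1 - h / (1 + h) v^T v] because
    [v^T v] is a projection. *)
Lemma quad_ellipsoid (R : realType) n (v b : 'rV[R]_n) (t r : R) :
  0 <= t -> 0 < r -> dotv v v = 1 ->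
  ellipsoid [set x | dotv (x - b) (x - b) + t * dotv (x - b) v ^+ 2 <= r].
Proof.
move=> t0 r0 v1.
pose h := Num.sqrt (1 + t) - 1; pose P := v^T *m v.
have h2 : (1 + h) ^+ 2 = 1 + t.
  by rewrite /h addrCA subrr addr0 sqr_sqrtr// addr_ge0.
have h0 : 1 + h != 0 by rewrite -sqrf_eq0 h2 gt_eqF// ltr_wpDr.
have q0 : Num.sqrt r != 0 by rewrite gt_eqF// sqrtr_gt0.
pose A := Num.sqrt r *: (1%:M - (h / (1 + h)) *: P).
pose B := (Num.sqrt r)^-1 *: (1%:M + h *: P).
have PP : P *m P = P.
  rewrite /P -mulmxA mulmx_rank1 v1; congr (_ *m _).
  by rewrite scale1r.
have AB : A *m B = 1%:M.
  rewrite /A /B -scalemxAl -scalemxAr scalerA divff// scale1r.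
  rewrite mulmxBl mul1mx -scalemxAl mulmxDr mulmx1 -scalemxAr PP.
  by rewrite -[X in _ *: (X + _)]scale1r -scalerDl scalerA divfK// addrK.
have BA : B *m A = 1%:M by exact: mulmx1C.
have qB y : dotv (y *m B) (y *m B) = (dotv y y + t * dotv y v ^+ 2) / r.
  have -> : y *m B = (Num.sqrt r)^-1 *: (y + (h * dotv y v) *: v).
    by rewrite /B -scalemxAr mulmxDr mulmx1 -scalemxAr mulmx_rank1 scalerA.
  rewrite dotvZl dotvZr mulrA -invfM -expr2 sqr_sqrtr ?ltW// mulrC.
  rewrite !(dotvDl, dotvDr, dotvZl, dotvZr) v1 (dotvC v y).
  have -> : t = (1 + h) ^+ 2 - 1 by rewrite h2 addrC addKr.
  by congr (_ / r); ring.
exists A, b; split; first by have [] := mulmx1_unit AB.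
apply/seteqP; split => x /=.
- move=> hx; exists ((x - b) *m B); last by rewrite -mulmxA BA mulmx1 subrK.
  by apply/mem_eball; rewrite qB ler_pdivrMr// mul1r.
- move=> [u /mem_eball hu <-]; rewrite addrK.
  by move: hu; rewrite -{1 2}(mulmx1 u) -AB mulmxA qB ler_pdivrMr// mul1r.
Qed.

(** Compare through the exponential:
    [(1 + t e)^n <= exp (n t e) < exp (t / (1 + t)) <= 1 + t]. *)
Lemma expn_lt_1D (R : realType) (n : nat) (t e : R) : 0 <= e -> 0 < t ->
  n%:R * e * (1 + t) < 1 -> (1 + t * e) ^+ n < 1 + t.
Proof.
move=> e0 t0 h.
have t1 : 0 < 1 + t by lra.
apply: (@le_lt_trans _ _ (expR (n%:R * (t * e)))).
  rewrite expRM_natl lerXn2r ?nnegrE ?expR_ge1Dx ?expR_ge0//.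
  by rewrite addr_ge0// mulr_ge0// ltW.
apply: (@lt_le_trans _ _ (expR (t / (1 + t)))).
  rewrite ltr_expR ltr_pdivlMr//.
  by rewrite [ltLHS](_ : _ = t * (n%:R * e * (1 + t))) ?gtr_pMr//; ring.
rewrite -[X in X <= _]invrK -expRN -[X in _ <= X]invrK.
rewrite lef_pV2 ?posrE ?invr_gt0 ?expR_gt0//.
by apply: le_trans (expR_ge1Dx _); rewrite le_eqVlt; apply/orP; left;
  apply/eqP; field; exact: lt0r_neq0.
Qed.

Lemma vol_quad_lt_ball (R : realType) n (v b : 'rV[R]_n) (t r : R) :
  0 <= t -> 0 < r -> dotv v v = 1 -> r ^+ n < 1 + t ->
  (vol [set x | dotv (x - b) (x - b) + t * dotv (x - b) v ^+ 2 <= r]%R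
    < vol (eball R n))%E.
Proof.
move=> t0 r0 v1 rt.
have -> : eball R n =
    [set x | dotv (x - 0) (x - 0) + 0 * dotv (x - 0) v ^+ 2 <= 1].
  by apply/seteqP; split => x /=; rewrite subr0 mul0r addr0 => /mem_eball.
rewrite !vol_quad// mul0r addr0 sqrtr1 divr1 v1 mulr1 lte_fin /radial_pow.
rewrite ler01 (ltW r0) sqrtr1 expr1n -mulrA ltr_pM2l; last first.
  by apply: prodr_gt0 => i _; exact: cap_mass_gt0.
have t1 : 0 < 1 + t by lra.
rewrite ltr_pdivrMr ?sqrtr_gt0// mul1r.
have rE : Num.sqrt r ^+ n = Num.sqrt (r ^+ n).
  rewrite -[LHS]ger0_norm ?exprn_ge0 ?sqrtr_ge0// -sqrtr_sqr.
  by rewrite exprAC sqr_sqrtr// ltW.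
by rewrite rE ltr_sqrt.
Qed.

(** * The slab bound *)

(** If [n * lo * hi > -1], cutting the ball by the slab leaves room for an
    ellipsoid of smaller volume: see the introduction. *)
Lemma slab_of_min_ball (R : realType) n (K : set 'rV[R]_n) (v : 'rV[R]_n)
    (lo hi : R) :
  min_vol_ellipsoid K (eball R n) -> dotv v v = 1 ->
  (forall x, K x -> lo <= dotv x v <= hi) -> n%:R * (lo * hi) <= -1.
Proof.
move=> [_ KB minB] v1 slab; rewrite leNgt; apply/negP => lohi.
(* Replacing - lo * hi by its positive part only enlarges the ellipsoid, and
   keeps its level r at least 1. *)
pose e := Num.max 0 (- (lo * hi)).
have e0 : 0 <= e by rewrite le_max lexx.
have eP : - (lo * hi) <= e by rewrite le_max lexx orbT.
have ne : n%:R * e < 1.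
  by rewrite /e; case: (leP 0 (- (lo * hi))) => _; rewrite ?mulr0//; lra.
pose M := ((lo + hi) / 2) ^+ 2.
have M0 : 0 <= M by exact: sqr_ge0.
have nM0 : 0 <= n%:R * M by rewrite mulr_ge0// ler0n.
have ne0 : 0 <= n%:R * e by rewrite mulr_ge0// ler0n.
(* With M as above, r = 1 + t * (e + t * M) bounds the level from above; the
   volume drops if n * (e + t * M) * (1 + t) < 1, which the following t
   achieves because t <= 1. *)
pose t := (1 - n%:R * e) / (2 * (1 + 2 * (n%:R * M))).
have den : 0 < 2 * (1 + 2 * (n%:R * M)) by lra.
have t0 : 0 < t by rewrite divr_gt0// subr_gt0.
have tE : t * (2 * (1 + 2 * (n%:R * M))) = 1 - n%:R * e.
  by rewrite /t mulfVK// gt_eqF.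
have t1 : t <= 1 by nra.
have eM0 : 0 <= e + t * M by rewrite addr_ge0// mulr_ge0// ltW.
have small : (1 + t * (e + t * M)) ^+ n < 1 + t.
  apply: expn_lt_1D => //.
  have -> : n%:R * (e + t * M) * (1 + t) =
    n%:R * e + t * (n%:R * e) + t * (1 + t) * (n%:R * M) by ring.
  by nra.
pose r := 1 + t * (e + t * M).
have r0 : 0 < r by rewrite ltr_wpDr// mulr_ge0// ltW.
(* The centre m *: v comes from completing the square along v. *)
pose m := t * (lo + hi) / (2 * (1 + t)).
have mE : m * (1 + t) = t * (lo + hi) / 2.
  by rewrite /m; field; rewrite gt_eqF// ltr_wpDr// ltW.
have m2 : m ^+ 2 * (1 + t) <= t ^+ 2 * M.
  have : m ^+ 2 * (1 + t) ^+ 2 = t ^+ 2 * M.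
    by rewrite -exprMn mE /M -exprMn mulrA.
  have := sqr_ge0 m.
  by nra.
have KE : K `<=` [set x | dotv (x - m *: v) (x - m *: v)
    + t * dotv (x - m *: v) v ^+ 2 <= r].
  move=> x Kx /=; have /mem_eball x1 := KB x Kx.
  have /andP[lx xh] := slab x Kx.
  rewrite !(dotvBl, dotvBr, dotvZl, dotvZr) v1 (dotvC v x).
  move: (dotv x v) lx xh => p lx xh.
  have -> : dotv x x - m * p - (m * p - m * (m * 1)) + t * (p - m * 1) ^+ 2 =
    dotv x x + t * (p ^+ 2) - 2 * p * (m * (1 + t)) + m ^+ 2 * (1 + t) by ring.
  rewrite mE.
  have : 0 <= t * ((p - lo) * (hi - p)).
    by rewrite mulr_ge0 ?(ltW t0)// mulr_ge0// subr_ge0.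
  have : t * - (lo * hi) <= t * e by rewrite ler_pM2l.
  by rewrite /r; nra.
have := minB _ (quad_ellipsoid (m *: v) (ltW t0) r0 v1) KE.
by rewrite leNgt (vol_quad_lt_ball _ (ltW t0) r0 v1).
Qed.

(** * Separation of a point from a compact convex set *)

Lemma dotv_sub_continuous (R : realType) n (p : 'rV[R]_n) :
  continuous (fun x : 'rV[R]_n => dotv (x - p) (x - p)).
Proof.
move=> x; have FF : Filter (nbhs x) := nbhs_filter x.
rewrite /dotv; apply: (@cvg_big _ _ _ _ _ (@add_continuous R^o) _ (nbhs x) _ _ _
  FF) => i _.
have c : (fun y : 'rV[R]_n => (y - p) 0 i) @ x --> (x - p) 0 i.
  have -> : (fun y : 'rV[R]_n => (y - p) 0 i) = (fun y => y 0 i - p 0 i).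
    by apply/funext => y; rewrite !mxE.
  have -> : (x - p) 0 i = x 0 i - p 0 i by rewrite !mxE.
  have cx : (fun y : 'rV[R]_n => y 0 i) @ x --> x 0 i.
    exact: coord_continuous.
  by have /(_ FF FF) := cvgB cx (cvg_cst (p 0 i)).
by have /(_ FF) := cvgM c c.
Qed.

Lemma sqdist_scaled (R : realType) n (l : R) (d w : 'rV[R]_n) :
  dotv (l *: d - w) (l *: d - w) =
  l * (l * dotv d d) - 2 * (l * dotv d w) + dotv w w.
Proof.
by rewrite !(dotvBl, dotvBr, dotvZl, dotvZr) (dotvC w d); ring.
Qed.

(** The normal vector joins the point [q] of [K] nearest to [p] to [p]: the
    angle at [q] between [p] and any [x] of [K] is obtuse, since otherwise a
    point of the segment from [q] to [x] would be nearer to [p]. *)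
Lemma strict_separation (R : realType) n (K : set 'rV[R]_n) (p : 'rV[R]_n) :
  compact K -> convex_set K -> K !=set0 -> ~ K p ->
  exists v q : 'rV[R]_n, [/\ dotv v v = 1, K q, dotv q v < dotv p v
    & forall x, K x -> dotv x v <= dotv q v].
Proof.
move=> cK vK K0 Kp.
have [q] := compact_EVT_min K0 cK
  (continuous_subspaceT (@dotv_sub_continuous R n p)).
rewrite inE => Kq qmin.
pose w := p - q.
have w0 : 0 < dotv w w.
  rewrite lt_neqAle dotv_ge0 andbT eq_sym dotv_eq0 subr_eq0.
  by apply/eqP => pq; apply: Kp; rewrite pq.
have obtuse x : K x -> dotv (x - q) w <= 0.
  move=> Kx; rewrite leNgt; apply/negP; set P := dotv _ _ => P0.
  pose Q := dotv (x - q) (x - q).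
  have Q0 : 0 <= Q by exact: dotv_ge0.
  have PQ : 0 < P + Q by rewrite ltr_pwDl.
  (* At q + l (x - q) the squared distance changes by l * (l * Q - 2 * P),
     which is negative for this l. *)
  pose l := P / (P + Q).
  have l0 : 0 < l by rewrite divr_gt0.
  have l1 : l <= 1 by rewrite ler_pdivrMr// mul1r lerDl.
  have lE : l * (P + Q) = P by rewrite /l mulfVK// gt_eqF.
  have Ky : (q + l *: (x - q)) \in K.
    have := @vK x q (Itv01 (ltW l0) l1).
    rewrite !inE => /(_ Kx Kq); congr (K _).
    rewrite /conv/= /unstable.onem scalerBl scale1r scalerBr.
    by rewrite addrCA.
  have := qmin _ Ky.
  have -> : q + l *: (x - q) - p = l *: (x - q) - w.
    by rewrite /w opprB addrAC addrC.
  have -> : q - p = (-1) *: w by rewrite scaleN1r opprB.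
  rewrite dotvZl dotvZr !mulN1r opprK sqdist_scaled -/P -/Q.
  have : l * (l * Q) <= l * P by rewrite ler_pM2l//; nra.
  have : 0 < l * P by rewrite mulr_gt0.
  by lra.
exists ((Num.sqrt (dotv w w))^-1 *: w), q.
have s0 : 0 < Num.sqrt (dotv w w) by rewrite sqrtr_gt0.
split => //.
- rewrite dotvZl dotvZr mulrA -invfM -expr2 sqr_sqrtr ?ltW// mulVf//.
  exact: lt0r_neq0.
- by rewrite !dotvZr ltr_pM2l ?invr_gt0// -subr_gt0 -dotvBl.
- move=> x Kx; rewrite !dotvZr ler_pM2l ?invr_gt0//.
  by rewrite -subr_le0 -dotvBl obtuse.
Qed.

Lemma dotv_le1 (R : realType) n (u v : 'rV[R]_n) :
  dotv u u <= 1 -> dotv v v = 1 -> dotv u v <= 1.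
Proof.
move=> u1 v1; have := dotv_ge0 (u - v).
by rewrite !(dotvBl, dotvBr) (dotvC v u) v1; lra.
Qed.

(** * Inclusion of the shrunk ball *)

Theorem lemma4p1 (R : realType) (n : nat) (hn : (0 < n)%N)
    (K : set 'rV[R]_n) (hK : convex_body K) (hL : loewner_position K)
    (c : 'rV[R]_n) (s : R) (hs : 1 <= s)
    (hKc : K `<=` [set s *: (c - x) + c | x in K]) :
  [set (1 / Num.sqrt (n%:R * s)) *: u + ((s + 1) / (2 * s)) *: c | u in eball R n]
    `<=` K.
Proof.
move=> _ [u /mem_eball u1 <-]; apply: contrapT => notK.
have [cK vK /(subset_nonempty (@interior_subset _ K)) K0] := hK.
have [v [q [v1 Kq + maxq]]] := strict_separation cK vK K0 notK.
rewrite dotvDl !dotvZl.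
have [minB _] := hL; have [_ KB _] := minB.
set h := dotv q v; set g := dotv c v; set w := 1 / _ => sep.
have ns : 0 < n%:R * s by rewrite mulr_gt0 ?ltr0n//; lra.
have w0 : 0 < w by rewrite /w div1r invr_gt0 sqrtr_gt0.
have w2 : (n%:R * s) * w ^+ 2 = 1.
  by rewrite /w div1r exprVn sqr_sqrtr ?(ltW ns)// divff// gt_eqF.
have h0 : 0 < h.
  have /(slab_of_min_ball minB v1) : forall x, K x -> -1 <= dotv x v <= h.
    move=> x Kx; rewrite maxq// andbT lerNl -mulN1r -dotvZl scaleN1r.
    apply: dotv_le1 => //; rewrite -scaleN1r dotvZl dotvZr !mulN1r opprK.
    exact/mem_eball/KB.
  rewrite mulN1r mulrN lerN2 => nh.
  by rewrite -(pmulr_rgt0 _ (_ : 0 < n%:R)) ?ltr0n// (lt_le_trans ltr01).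
have slab : n%:R * (((s + 1) * g - s * h) * h) <= -1.
  apply: (slab_of_min_ball minB v1) => x Kx; rewrite maxq// andbT.
  have [y Ky <-] := hKc x Kx.
  rewrite dotvDl dotvZl dotvBl -/g.
  have : s * dotv y v <= s * h by rewrite ler_pM2l ?maxq//; lra.
  by lra.
pose a := (s + 1) / (2 * s) * g.
have aE : (s + 1) * g = 2 * s * a by rewrite /a; field; lra.
have wu : w * dotv u v <= w by rewrite ler_piMr ?(ltW w0)// dotv_le1.
have lower : w ^+ 2 <= h * (h - 2 * a).
  by rewrite -(ler_pM2l ns) w2; rewrite aE in slab; lra.
have {sep} sep : h < w + a by apply: lt_le_trans sep _; rewrite lerD2r.
have [ah|ha] := leP a h; first by nra.
by have : h * (2 * a - h) > 0; [rewrite mulr_gt0//; lra | nra].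
Qed.
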